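(* For a set $\mathcal{W} \subseteq \mathbb{Z}^d$ of lattice points, the following are equivalent. (1) $\mathcal{W}$ possesses an affine stratification. (2) $\mathcal{W}$ is a finite (not necessarily disjoint) union of sets $W_i$, each of which is a finitely generated module for an affine semigroup $A_i \subseteq \mathbb{Z}^d$. (3) $\mathcal{W}$ is a finite (not necessarily disjoint) union of sets $W_i$, each of which is a translate $f_i + A_i$ ($f_i \in \mathbb{Z}^d$) of an affine semigroup $A_i \subseteq \mathbb{Z}^d$. (4) $\mathcal{W}$ is a finite (not necessarily disjoint) union of sets $W_i$, each of which is a translate $f_i + A_i$ of a normal affine semigroup $A_i \subseteq \mathbb{Z}^d$. (5) $\mathcal{W}$ is a finite disjoint union of sets $W_i$, each of which is a translate $f_i + A_i$ of a normal affine semigroup $A_i \subseteq \mathbb{Z}^d$. (6) $\mathcal{W}$ is a finite disjoint union of sets $W_i$, each of which is a translate $f_i + A_i$ of a (not necessarily normal) affine semigroup $A_i \subseteq \mathbb{Z}^d$.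
   Context: An affine semigroup is a finitely generated submonoid of $\mathbb{Z}^d$. A normal affine semigroup is the intersection of a rational polyhedral cone in $\mathbb{R}^d$ with a sublattice of $\mathbb{Z}^d$. A subset $W \subseteq \mathbb{Z}^d$ is a finitely generated module for an affine semigroup $A$ if $W = F + A$ for some finite $F \subseteq \mathbb{Z}^d$. An affine stratification of $\mathcal{W} \subseteq \mathbb{Z}^d$ is a partition $\mathcal{W} = \biguplus_{i=1}^r W_i$ into finitely many pairwise disjoint sets, each a finitely generated module for some affine semigroup $A_i \subseteq \mathbb{Z}^d$. *)

(* Defs.v *)
From mathcomp Require Import all_boot all_order all_algebra.
From mathcomp Require Import boolp classical_sets functions cardinality reals.

Set Implicit Arguments.
Unset Strict Implicit.
Unset Printing Implicit Defensive.

Import Order.TTheory GRing.Theory Num.Theory.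

Local Open Scope classical_set_scope.
Local Open Scope ring_scope.

Section AffineSemigroups.
Variable d : nat.
Implicit Types A F L W V : set 'rV[int]_d.

Definition submonoid A := GRing.nmod_closed [in A].

Definition affine_semigroup A :=
  exists2 G : set 'rV[int]_d, finite_set G & A = smallest submonoid G.

(* Sublattices need not have full rank. *)
Definition sublattice L := GRing.zmod_closed [in L].

(* A finite intersection of closed half-spaces through the origin, whose inner
   normals are the columns of the rational matrix [M]. *)
Definition rational_polyhedral_cone (R : realType) (C : set 'rV[R]_d) :=
  exists (m : nat) (M : 'M[rat]_(d, m)),
    C = [set x | forall j : 'I_m, 0 <= (x *m map_mx ratr M) 0 j].

(* Finite generation is not required here: it is Gordan's lemma. *)
Definition normal_affine_semigroup (R : realType) A :=
  exists (C : set 'rV[R]_d) (L : set 'rV[int]_d),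
    [/\ rational_polyhedral_cone C, sublattice L &
        A = map_mx intr @^-1` C `&` L].

(* [F] may be empty, so the empty set is a finitely generated module. *)
Definition fg_module A W :=
  exists2 F : set 'rV[int]_d, finite_set F & W = [set f + a | f in F & a in A].

Definition translate A W := exists f : 'rV[int]_d, W = [set f + a | a in A].

(* The number [r] of pieces may be [0]. *)
Definition finite_union_of (P : set 'rV[int]_d -> Prop) W :=
  exists (r : nat) (W_ : 'I_r -> set 'rV[int]_d),
    (forall i, P (W_ i)) /\ W = \bigcup_i W_ i.

Definition finite_disjoint_union_of (P : set 'rV[int]_d -> Prop) W :=
  exists (r : nat) (W_ : 'I_r -> set 'rV[int]_d),
    [/\ forall i, P (W_ i), trivIset [set: 'I_r] W_ & W = \bigcup_i W_ i].

Definition has_affine_stratification W :=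
  finite_disjoint_union_of
    (fun V => exists2 A, affine_semigroup A & fg_module A V) W.

End AffineSemigroups.

(* Main.v *)
(* Definable sets, i.e. finite unions of cells cut out by affine inequalities [0 <= l x] and
   divisibilities [m %| l x], are stable under [X |-> X + N g]: taking the least number of
   steps, it is either bounded or the base point lies on one of finitely many level sets of
   a form strictly decreasing along [g], and there the number of steps is determined by the
   end point.  Hence translates of affine semigroups are definable.  Conversely a definable
   set is a disjoint union of cells, and a cell is a disjoint union of translates of normal
   semigroups by induction on the number of inequalities: the part above a chosen point [f]
   is a translated cone, and the rest lies on finitely many level sets.  Normal semigroups
   are finitely generated by Dickson's lemma (Gordan). *)
From HB Require Import structures.
Require Import Defs.
From mathcomp Require Import all_boot all_order all_algebra.
From mathcomp Require Import boolp classical_sets functions cardinality reals.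
From mathcomp Require Import zify ring.

Set Implicit Arguments.
Unset Strict Implicit.
Unset Printing Implicit Defensive.

Import Order.TTheory GRing.Theory Num.Theory.

Local Open Scope classical_set_scope.
Local Open Scope ring_scope.

(** * Definable sets and their stability under adding a ray *)

Section Definable.
Variable V : zmodType.
Implicit Types (x y z g : V) (X Y : set V).

(** Affineness is stated through the ternary operation [x - y + z], so no linear part has to be
    carried along; it is recovered as [slope]. *)
Record affine_form := AffineForm {
  form_val :> V -> int;
  form_affine : forall x y z,
    form_val (x - y + z) = form_val x - form_val y + form_val z }.
Implicit Types l : affine_form.

Fact affine_comb_subproof a l b l' c x y z :
  let f t := a * l t + b * l' t + c in f (x - y + z) = f x - f y + f z.
Proof. by rewrite /= !form_affine; ring. Qed.
Definition affine_comb a l b l' c := AffineForm (affine_comb_subproof a l b l' c).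

Fact affine_shift_subproof l g x y z :
  let f t := l (t - g) in f (x - y + z) = f x - f y + f z.
Proof. by rewrite /= -form_affine; congr (l _); rewrite opprB !addrA subrK. Qed.
Definition affine_shift l g := AffineForm (affine_shift_subproof l g).

Definition slope l g := l g - l 0.

Lemma formD l x y : l (x + y) = l x + slope l y.
Proof. by rewrite -[x in LHS]subr0 form_affine /slope; ring. Qed.

Fact slope_is_additive l : zmod_morphism (slope l).
Proof. by move=> x y; rewrite /slope -[x - y]addr0 form_affine; ring. Qed.
HB.instance Definition _ l :=
  GRing.isZmodMorphism.Build V int (slope l) (slope_is_additive l).

Lemma formDMn l x g n : l (x + g *+ n) = l x + slope l g * n%:Z.
Proof. by rewrite formD raddfMn -mulr_natr natz. Qed.

Lemma formBMn l x g n : l (x - g *+ n) = l x - slope l g * n%:Z.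
Proof. by rewrite formD raddfN raddfMn -mulr_natr natz. Qed.

Inductive atom := Nonneg of affine_form | Divides of nat & affine_form.

(* The modulus of [Divides m l] is [m.+1], hence never zero. *)
Definition holds x a :=
  match a with
  | Nonneg l => 0 <= l x
  | Divides m l => (m.+1 %| l x)%Z
  end.

Definition cell (B : seq atom) : set V := [set x | all (holds x) B].

Definition definable X :=
  exists Bs : seq (seq atom), X = [set x | has (all (holds x)) Bs].

Lemma definable_cell B : definable (cell B).
Proof. by exists [:: B]; apply/seteqP; split=> x /=; rewrite orbF. Qed.

Lemma definable0 : definable set0.
Proof. by exists [::]; apply/seteqP; split. Qed.

Lemma definableU X Y : definable X -> definable Y -> definable (X `|` Y).
Proof.
move=> [Bs ->] [Cs ->]; exists (Bs ++ Cs); apply/seteqP; split=> x /=.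
  by rewrite has_cat; case=> ->; rewrite ?orbT.
by rewrite has_cat => /orP.
Qed.

Lemma definable_bigcup_seq (I : Type) (s : seq I) (X_ : I -> set V) :
  (forall i, definable (X_ i)) ->
  definable (foldr (fun i Y => X_ i `|` Y) set0 s).
Proof. by move=> dX; elim: s => [|i s IH]; [exact: definable0 | exact: definableU]. Qed.

Lemma definable_bigcup (I : finType) (X_ : I -> set V) :
  (forall i, definable (X_ i)) -> definable (\bigcup_i X_ i).
Proof.
move=> dX; suff -> : \bigcup_i X_ i = foldr (fun i Y => X_ i `|` Y) set0 (enum I).
  exact: definable_bigcup_seq.
have E s : foldr (fun i Y => X_ i `|` Y) set0 s = [set x | exists2 i, i \in s & X_ i x].
  elim: s => [|i s IH] /=; first by apply/seteqP; split=> x // [].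
  rewrite IH; apply/seteqP; split=> x /=.
    case=> [Xx|[j js Xx]]; first by exists i; rewrite ?mem_head.
    by exists j; rewrite // inE js orbT.
  case=> j; rewrite inE => /orP[/eqP->|js] Xx; first by left.
  by right; exists j.
rewrite E; apply/seteqP; split=> x /= [i _ Xx]; exists i => //.
by rewrite mem_enum.
Qed.

Definition shift_atom g a :=
  match a with
  | Nonneg l => Nonneg (affine_shift l g)
  | Divides m l => Divides m (affine_shift l g)
  end.

Lemma holds_shift g x a : holds x (shift_atom g a) = holds (x - g) a.
Proof. by case: a. Qed.

Lemma definable_shift g X : definable X -> definable [set x | X (x - g)].
Proof.
move=> [Bs ->]; exists (map (map (shift_atom g)) Bs); congr mkset; apply/funext => x.
rewrite has_map; congr is_true; apply: eq_has => B /=; rewrite all_map.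
by apply: eq_all => a /=; rewrite holds_shift.
Qed.

(* If [l x = v - q n], with [q] minus the slope of [l], the number of steps [n] is an
   affine function of [x] up to the denominator [q]. *)
Definition unstep_form l v g l' :=
  affine_comb (- slope l g) l' (slope l' g) l (- (v * slope l' g)).

Definition unstep_atom l v g a :=
  match a with
  | Nonneg l' => Nonneg (unstep_form l v g l')
  | Divides m l' => Divides (`|slope l g| * m.+1).-1 (unstep_form l v g l')
  end.

(** The unstepped form takes at [x] the value of [l'] at the base point times [q = - slope l g]. As
    [q] is positive, signs agree, and divisibility agrees once the modulus is multiplied by [q]. *)
Lemma holds_unstep l v g n x a : slope l g < 0 -> l (x - g *+ n) = v ->
  holds x (unstep_atom l v g a) = holds (x - g *+ n) a.
Proof.
move=> sl_lt0 lv.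
have E l' : unstep_form l v g l' x = - slope l g * l' (x - g *+ n).
  by rewrite /unstep_form /= -lv !formBMn; ring.
case: a => [l'|m l']; rewrite /holds /unstep_atom E.
  by rewrite pmulr_rge0 // oppr_gt0.
rewrite prednK; last by rewrite muln_gt0 absz_gt0 lt_eqF.
by rewrite PoszM ltz0_abs // dvdz_mul2l // oppr_eq0 lt_eqF.
Qed.

(** With [w = v - l x] and [q = - slope l g], the two atoms on [w] say that the only possible number
    of steps, [w / q], is a natural number. *)
Lemma definable_ray_level l v g B : slope l g < 0 ->
  definable [set x | exists n, l (x - g *+ n) = v /\ cell B (x - g *+ n)].
Proof.
move=> sl_lt0; pose w := affine_comb (-1) l 0 l v.
have -> : [set x | exists n, l (x - g *+ n) = v /\ cell B (x - g *+ n)] =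
    cell (Nonneg w :: Divides `|slope l g|.-1 w :: map (unstep_atom l v g) B).
  have q_gt0 : (0 < `|slope l g|)%N by lia.
  have qE : Posz `|slope l g|%N = - slope l g by lia.
  have cellE x : cell (Nonneg w :: Divides `|slope l g|.-1 w :: map (unstep_atom l v g) B) x =
      [&& 0 <= w x, (- slope l g %| w x)%Z & all (fun a => holds x (unstep_atom l v g a)) B].
    by rewrite /cell /= all_map prednK // qE.
  apply/seteqP; split=> x; rewrite cellE.
    case=> n [lv Bx]; have := lv; rewrite formBMn => lv'.
    have wE : w x = n%:Z * - slope l g by rewrite /w /=; lia.
    rewrite wE dvdz_mull // mulr_ge0 ?oppr_ge0 ?(ltW sl_lt0) //=.
    by apply: sub_all Bx => a ha; rewrite (holds_unstep _ sl_lt0 lv).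
  move=> /and3P[w_ge0 /dvdzP[k wE] Bx].
  have k_ge0 : 0 <= k by move: w_ge0; rewrite wE pmulr_lge0 // oppr_gt0.
  have lv : l (x - g *+ `|k|) = v.
    by rewrite formBMn gez0_abs //; move: wE; rewrite /w /=; lia.
  exists `|k|%N; split=> //; apply: sub_all Bx => a.
  by rewrite (holds_unstep _ sl_lt0 lv).
exact: definable_cell.
Qed.

(* A long enough step along [g] preserves all divisibility atoms, so it can leave the cell
   only through one of finitely many level sets of forms decreasing along [g]. *)
Lemma cell_exit B g : exists2 P : nat, (0 < P)%N &
  forall k, exists T : seq (affine_form * nat),
  all (fun t : affine_form * nat => slope t.1 g < 0) T /\
  forall y, cell B y -> ~~ all (holds (y + g *+ (k * P))) B ->
    has (fun t : affine_form * nat => t.1 y == t.2) T.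
Proof.
elim: B => [|a B [P P_gt0 IH]]; first by exists 1%N => // k; exists [::].
case: a => [l|m l].
  exists P => // k; have [T [sT exT]] := IH k.
  (* If [l] becomes negative after [k * P] steps, then its slope is negative and its value at [y] is
     less than the total decrease [N]. *)
  pose N := if slope l g < 0 then (`|slope l g| * (k * P))%N else 0%N.
  exists ([seq (l, v) | v <- iota 0 N] ++ T); split.
    rewrite all_cat sT andbT all_map /N; case: ifP => sl //=.
    by apply/allP.
  move=> y /andP[/= ly By]; rewrite negb_and => /orP[ly'|By'].
    rewrite has_cat; apply/orP; left; rewrite has_map; apply/hasP.
    move: ly'; rewrite formDMn => ly'; exists `|l y|%N; last by rewrite /=; lia.
    rewrite mem_iota /N; case: ltP => sl; nia.
  by rewrite has_cat (exT y) ?orbT.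
(* With the factor [m.+1] in the period, a step changes [l] by a multiple of the modulus. The
   induction hypothesis for period [P] is then used at [k * m.+1], which is why the statement
   quantifies over [k]. *)
exists (P * m.+1)%N; first by rewrite muln_gt0 P_gt0.
move=> k; have [T [sT exT]] := IH (k * m.+1)%N.
exists T; split=> // y /andP[/= ly By].
have -> : (k * (P * m.+1) = k * m.+1 * P)%N by lia.
have ly' : (m.+1 %| l (y + g *+ (k * m.+1 * P)))%Z.
  by rewrite formDMn rpredD // dvdz_mull // dvdzE dvdn_mulr // dvdn_mull.
by rewrite ly'; exact: exT.
Qed.

Lemma definable_ray g X : definable X -> definable [set x | exists n, X (x - g *+ n)].
Proof.
have cellP B : definable [set x | exists n, cell B (x - g *+ n)].
  have [P P_gt0 /(_ 1%N)[T [sT exT]]] := cell_exit B g.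
  rewrite mul1n in exT.
  pose ray (t : affine_form * nat) :=
    [set x | exists n, t.1 (x - g *+ n) = Posz t.2 /\ cell B (x - g *+ n)].
  have -> : [set x | exists n, cell B (x - g *+ n)] =
      (\bigcup_(n : 'I_P) [set x | cell B (x - g *+ n)]) `|`
      (\bigcup_(i : 'I_(size T)) ray (tnth (in_tuple T) i)).
    apply/seteqP; split=> x; last first.
      by case=> [[n _ Bx]|[i _ [n [_ Bx]]]]; exists n.
    move=> exn; have [n Bn minn] := ex_minnP exn.
    have [n_lt|P_le] := ltnP n P; first by left; exists (Ordinal n_lt).
    (* Since [n] is least, moving [P] steps forward from [x - g *+ n] leaves the cell, so this base
       point lies on a level set listed in [T]. *)
    right; have : has (fun t : affine_form * nat => t.1 (x - g *+ n) == t.2) (in_tuple T).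
      apply: exT Bn _; apply: contraTN P_gt0 => Bn'; rewrite -leqNgt.
      have : cell B (x - g *+ (n - P)) by rewrite mulrnBr // opprB addrA addrAC.
      by move=> /minn; lia.
    by move=> /has_tnthP[i /eqP iE]; exists i => //; exists n.
  apply: definableU; apply: definable_bigcup => i.
    exact/definable_shift/definable_cell.
  apply: definable_ray_level.
  exact: (@all_tnthP _ _ (fun t : affine_form * nat => slope t.1 g < 0) (in_tuple T) sT).
move=> [Bs ->].
elim: Bs => [|B Bs IH].
  rewrite (_ : mkset _ = set0); first exact: definable0.
  by apply/seteqP; split=> x // -[].
suff -> : [set x | exists n, has (all (holds (x - g *+ n))) (B :: Bs)] =
  [set x | exists n, cell B (x - g *+ n)] `|`
  [set x | exists n, has (all (holds (x - g *+ n))) Bs] by apply: definableU.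
apply/seteqP; split=> x /=.
  by case=> n /orP[]; [left | right]; exists n.
by case=> -[n Bx]; exists n; apply/orP; [left|right].
Qed.

End Definable.

(** Dickson's lemma, by induction on [fs]. A finite set [F0] works for the tail of [fs]; if [N]
    bounds [f] on [F0], it also works for the points with [f s >= N]. The finitely many slices
    [f s = v] with [v < N] are handled separately. *)
Lemma dickson (T : eqType) (fs : seq (T -> nat)) (S : set T) :
  exists F : seq T, (forall t, t \in F -> S t) /\
    forall s, S s -> exists2 t, t \in F & all (fun f => f t <= f s)%N fs.
Proof.
elim: fs S => [|f fs IH] S.
  have [[s0 Ss0]|S0] := pselect (exists s, S s).
    exists [:: s0]; split; first by move=> t; rewrite inE => /eqP->.
    by move=> s _; exists s0; rewrite ?mem_head.
  by exists [::]; split=> // s Ss; case: S0; exists s.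
have [F0 [F0S domF0]] := IH S.
have [F_ FP] := choice (fun v => IH (S `&` [set s | f s = v])).
pose N := (\max_(t <- F0) f t)%N.
exists (F0 ++ flatten [seq F_ v | v <- iota 0 N]); split.
  move=> t; rewrite mem_cat => /orP[/F0S //|/flattenP[_ /mapP[v _ ->] tF]].
  by have [/(_ t tF)[]] := FP v.
move=> s Ss; have [N_le|lt_N] := leqP N (f s).
  have [t tF0 ts] := domF0 s Ss; exists t; first by rewrite mem_cat tF0.
  by rewrite /= ts andbT (leq_trans _ N_le) // /N leq_bigmax_seq.
have [_ /(_ s)[//|t tF ts]] := FP (f s).
exists t; last by rewrite /= ts andbT; have [/(_ t tF)[_ ->]] := FP (f s).
rewrite mem_cat; apply/orP; right; apply/flattenP; exists (F_ (f s)) => //.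
by apply: map_f; rewrite mem_iota.
Qed.

(** * Finite unions over arbitrary finite index types, and their nesting *)

Section FiniteUnions.
Variables (d : nat) (P : set 'rV[int]_d -> Prop).
Implicit Types W X Y : set 'rV[int]_d.

Lemma finite_union_ofT (I : finType) (W_ : I -> set 'rV[int]_d) :
  (forall i, P (W_ i)) -> finite_union_of P (\bigcup_i W_ i).
Proof.
move=> PW; exists #|I|, (W_ \o enum_val); split=> [i|]; first exact: PW.
apply/seteqP; split=> x [i _ Wx]; last by exists (enum_val i).
by exists (enum_rank i); rewrite //= enum_rankK.
Qed.

Lemma finite_union_of_bigcup (I : finType) (W_ : I -> set 'rV[int]_d) :
  (forall i, finite_union_of P (W_ i)) -> finite_union_of P (\bigcup_i W_ i).
Proof.
move=> PW; pose r i := projT1 (cid (PW i)); pose U i := projT1 (cid (projT2 (cid (PW i)))).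
have UP i := projT2 (cid (projT2 (cid (PW i)))).
suff -> : \bigcup_i W_ i = \bigcup_(p : {i & 'I_(r i)}) U (tag p) (tagged p).
  by apply: finite_union_ofT => -[i k]; have [PU _] := UP i; exact: PU.
apply/seteqP; split=> x.
  move=> [i _]; have [_ ->] := UP i; move=> [k _ Ux].
  by exists (Tagged (fun i => 'I_(r i)) k).
by move=> [[i k] _ Ux]; exists i => //; have [_ ->] := UP i; exists k.
Qed.

Lemma finite_disjoint_union_ofT (I : finType) (W_ : I -> set 'rV[int]_d) :
  (forall i, P (W_ i)) -> trivIset [set: I] W_ ->
  finite_disjoint_union_of P (\bigcup_i W_ i).
Proof.
move=> PW tW; exists #|I|, (W_ \o enum_val); split=> [i||]; first exact: PW.
  by move=> i j _ _ /tW tij; apply: enum_val_inj; exact: tij.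
apply/seteqP; split=> x [i _ Wx]; last by exists (enum_val i).
by exists (enum_rank i); rewrite //= enum_rankK.
Qed.

Lemma finite_disjoint_union_of_bigcup (I : finType) (W_ : I -> set 'rV[int]_d) :
  (forall i, finite_disjoint_union_of P (W_ i)) -> trivIset [set: I] W_ ->
  finite_disjoint_union_of P (\bigcup_i W_ i).
Proof.
move=> PW tW; pose r i := projT1 (cid (PW i)); pose U i := projT1 (cid (projT2 (cid (PW i)))).
have UP i := projT2 (cid (projT2 (cid (PW i)))).
suff -> : \bigcup_i W_ i = \bigcup_(p : {i & 'I_(r i)}) U (tag p) (tagged p).
  apply: finite_disjoint_union_ofT => [[i k]|]; first by have [PU _ _] := UP i; exact: PU.
  move=> [i k] [j m] _ _ /= [x [Ux Ux']].
  have [_ ti Wi] := UP i; have [_ _ Wj] := UP j.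
  have ij : i = j.
    by apply: tW => //; exists x; rewrite Wi Wj; split; [exists k | exists m].
  case: j / ij m Ux' {Wj} => m Ux'; congr existT; apply: ti => //; by exists x.
apply/seteqP; split=> x.
  move=> [i _]; have [_ _ ->] := UP i; move=> [k _ Ux].
  by exists (Tagged (fun i => 'I_(r i)) k).
by move=> [[i k] _ Ux]; exists i => //; have [_ _ ->] := UP i; exists k.
Qed.

Lemma finite_disjoint_union_of0 : finite_disjoint_union_of P set0.
Proof.
rewrite (_ : set0 = \bigcup_(i : void) set0); last by apply/seteqP; split=> x // [].
exact: finite_disjoint_union_ofT.
Qed.

Lemma finite_disjoint_union_of1 X : P X -> finite_disjoint_union_of P X.
Proof.
move=> PX; rewrite (_ : X = \bigcup_(i : unit) X).
  by apply: finite_disjoint_union_ofT => // -[] [].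
by apply/seteqP; split=> x; [exists tt | case].
Qed.

Lemma finite_disjoint_union_ofU X Y :
  finite_disjoint_union_of P X -> finite_disjoint_union_of P Y ->
  X `&` Y = set0 -> finite_disjoint_union_of P (X `|` Y).
Proof.
move=> dX dY XY0.
rewrite (_ : X `|` Y = \bigcup_(b : bool) if b then X else Y); last first.
  by apply/seteqP; split=> x; [case; [exists true|exists false] | case=> -[] _; [left|right]].
apply: finite_disjoint_union_of_bigcup => [[]//|].
by move=> [] [] // _ _ [x [Xx Yx]]; have : set0 x by rewrite -XY0.
Qed.

Lemma finite_union_of_disjoint W :
  finite_disjoint_union_of P W -> finite_union_of P W.
Proof. by move=> [r [W_ [PW _ WE]]]; exists r, W_. Qed.

End FiniteUnions.

Lemma finite_union_of_sub d (P Q : set 'rV[int]_d -> Prop) W :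
  (forall X, P X -> Q X) -> finite_union_of P W -> finite_union_of Q W.
Proof. by move=> PQ [r [W_ [PW ->]]]; exists r, W_; split=> // i; apply/PQ. Qed.

Lemma finite_disjoint_union_of_sub d (P Q : set 'rV[int]_d -> Prop) W :
  (forall X, P X -> Q X) ->
  finite_disjoint_union_of P W -> finite_disjoint_union_of Q W.
Proof. by move=> PQ [r [W_ [PW tW ->]]]; exists r, W_; split=> // i; apply/PQ. Qed.

(** * Gordan's lemma *)

Section Gordan.
Variables (R : realType) (d : nat).

(** Denominators are cleared column by column: column [j] is multiplied by the positive integer
    [D j], which preserves signs. *)
Lemma cone_mx_int m (M : 'M[rat]_(d, m)) : exists N : 'M[int]_(d, m),
  forall (y : 'rV[int]_d) j,
    (0 <= (map_mx intr y *m map_mx ratr M) 0 j :> R) = (0 <= (y *m N) 0 j).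
Proof.
pose D j := \prod_k denq (M k j).
exists (\matrix_(i, j) (numq (M i j) * \prod_(k | k != i) denq (M k j))) => y j.
have D_gt0 : 0 < (D j)%:~R :> R by rewrite ltr0z prodr_gt0 // => k _; exact: denq_gt0.
rewrite -(pmulr_rge0 _ D_gt0) -(ler0z R) !mxE mulr_sumr rmorph_sum.
congr (0 <= _); apply: eq_bigr => i _; rewrite !mxE mulrCA [RHS]rmorphM; congr (_ * _).
rewrite /D (bigD1 i) //= !intrM [RHS]mulrC mulrAC mulrC; congr (_ * _).
by rewrite -ratr_int -rmorphM /= mulrC -numqE ratr_int.
Qed.

(** The generators are the nonzero elements given by Dickson's lemma for [fs]. If [t] is below [x]
    for all of [fs], then [x - t] still satisfies the inequalities and has smaller [norm], so
    descent on [norm] writes [x] as a sum of generators. *)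
Lemma gordan (A : set 'rV[int]_d) : normal_affine_semigroup R A -> affine_semigroup A.
Proof.
move=> [_ [L [[m [M ->]] [L0 LB] AE]]].
have [N NP] := cone_mx_int M.
have LD x y : L x -> L y -> L (x + y).
  move=> Lx Ly; have := LB x (0 - y); rewrite !inE sub0r opprK; apply=> //.
  by have := LB 0 y; rewrite !inE sub0r; apply=> //; rewrite -inE.
have {}AE x : A x <-> L x /\ forall j, 0 <= (x *m N) 0 j.
  rewrite AE; split=> [[/= Cx Lx]|[Cx Lx]]; split=> //= j; first by rewrite -NP.
  by rewrite NP.
pose norm (x : 'rV[int]_d) := (\sum_i `|x ord0 i|)%N.
(* Besides the cone inequalities, [fs] records the positive and negative parts of the coordinates.
   Comparing both makes [norm] additive along [x = (x - t) + t]. *)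
pose fs := [seq (fun x : 'rV[int]_d => absz ((x *m N) 0 j)) | j <- enum 'I_m] ++
   [seq (fun x : 'rV[int]_d => absz (Num.max (x ord0 i) 0)) | i <- enum 'I_d] ++
   [seq (fun x : 'rV[int]_d => absz (Num.min (x ord0 i) 0)) | i <- enum 'I_d].
have [F [FA domF]] := dickson fs (A `&` [set x | x != 0]).
exists [set` F]; first exact: finite_seq.
apply/seteqP; split=> x; last first.
  apply: smallest_sub => //; last by move=> y /FA[].
  split; first by rewrite inE; apply/AE; split=> [|j]; [rewrite -inE | rewrite mul0mx mxE].
  move=> y z; rewrite !inE => /AE[Ly Ny] /AE[Lz Nz]; apply/AE; split; first exact: LD.
  by move=> j; rewrite mulmxDl mxE addr_ge0.
move=> Ax B [Bsub FB]; have [n] := ubnP (norm x).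
elim: n x Ax => // n IH x Ax le_n.
have [->|x0] := eqVneq x 0; first by have [] := Bsub; rewrite inE.
have [//|t tF] := domF x _.
rewrite !all_cat !all_map => /and3P[/allP tN /allP tp /allP tm].
have [At t0] := FA t tF.
have /AE[Lx Nx] := Ax; have /AE[Lt Nt] := At.
have normE : (norm (x - t)%R + norm t = norm x)%N.
  rewrite /norm -big_split; apply: eq_bigr => i _ /=; rewrite !mxE.
  have := tp i; have := tm i; rewrite -enumT mem_enum /= => /(_ isT) + /(_ isT).
  move: (x ord0 i) (t ord0 i) => a b; lia.
have norm_t : (0 < norm t)%N.
  rewrite lt0n sum_nat_eq0; apply: contra t0 => /forallP t0; apply/eqP/rowP => i.
  by rewrite mxE; apply/eqP; rewrite -absz_eq0; exact: (implyP (t0 i)).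
rewrite -(subrK t x) -inE; have [_ BD] := Bsub.
apply: BD; rewrite inE; last exact: FB.
apply: IH; last by rewrite -ltnS; apply: leq_trans le_n; rewrite ltnS -normE -addn1 leq_add2l.
apply/AE; split; first by have := LB x t; rewrite !inE; apply.
move=> j; have := Nt j; have := Nx j; have := tN j.
have -> : ((x - t) *m N) 0 j = (x *m N) 0 j - (t *m N) 0 j.
  by rewrite mulmxBl mxE [X in _ + X]mxE.
rewrite -enumT mem_enum /= => /(_ isT).
by move: ((x *m N) 0 j) ((t *m N) 0 j) => a b; lia.
Qed.
End Gordan.

(** * Disjoint decomposition of definable sets into translates of normal semigroups *)

Section Decomposition.
Variables (R : realType) (d : nat).
Local Notation V := 'rV[int]_d.
Implicit Types (K X : set V) (l : affine_form V).

Let normal_translate X := exists2 A, normal_affine_semigroup R A & translate A X.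

(** Such a set is empty or a coset of a subgroup. *)
Definition affine_closed K := forall x y z, K x -> K y -> K z -> K (x - y + z).

Lemma affine_closedI K X : affine_closed K -> affine_closed X -> affine_closed (K `&` X).
Proof. by move=> cK cX x y z [Kx Xx] [Ky Xy] [Kz Xz]; split; [apply: cK | apply: cX]. Qed.

Lemma affine_closed_level l v : affine_closed [set x | l x = v].
Proof. by move=> x y z /= lx ly lz; rewrite form_affine lx ly lz subrr add0r. Qed.

Lemma affine_closed_dvd l m : affine_closed [set x | (m %| l x)%Z].
Proof. by move=> x y z /= lx ly lz; rewrite form_affine rpredD ?rpredB. Qed.

Definition region K (ls : seq (affine_form V)) : set V :=
  [set x | K x /\ all (fun l : affine_form V => 0 <= l x) ls].

Lemma slope_sum l (y : V) : slope l y = \sum_i y 0 i * slope l (delta_mx 0 i).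
Proof.
rewrite {1}[y]row_sum_delta raddf_sum; apply: eq_bigr => i _.
by rewrite -[y 0 i in LHS]intz scaler_int raddfMz mulrzz mulrC.
Qed.

(** After translation by [- f], the set [K] becomes a sublattice and the forms, which vanish at [f],
    become linear. Their values on the basis vectors are the entries of the cone matrix. *)
Lemma region_apex K ls f : affine_closed K -> K f ->
  all (fun l : affine_form V => l f == 0) ls -> normal_translate (region K ls).
Proof.
move=> cK Kf /(@all_tnthP _ _ _ (in_tuple ls)) lsf.
exists [set y | region K ls (f + y)]; last first.
  exists f; apply/seteqP; split=> x; last by case=> y Ty <-.
  by exists (x - f); rewrite /= addrC subrK.
pose M : 'M[rat]_(d, size ls) :=
  \matrix_(i, j) (slope (tnth (in_tuple ls) j) (delta_mx 0 i))%:~R.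
exists [set x | forall j, 0 <= (x *m map_mx ratr M) 0 j], [set y | K (f + y)].
split; first by exists (size ls), M.
  split; first by rewrite inE /= addr0.
  move=> x y; rewrite !inE /= => Kx Ky; have := cK _ _ _ Kx Ky Kf.
  by rewrite opprD addrACA subrr add0r [X in K X]addrC.
have ME y j : (map_mx intr y *m map_mx ratr M) 0 j = (tnth (in_tuple ls) j (f + y))%:~R :> R.
  rewrite formD (eqP (lsf j)) add0r slope_sum mxE rmorph_sum; apply: eq_bigr => i _.
  by rewrite !mxE ratr_int -intrM.
apply/seteqP; split=> y /=.
  case=> Ky /(@all_tnthP _ _ _ (in_tuple ls)) ly; split=> // j; rewrite ME ler0z.
    exact: (ly j).
case=> Cy Ky; split=> //; apply/(@all_tnthP _ _ _ (in_tuple ls)) => j.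
by have := Cy j; rewrite ME ler0z.
Qed.

(* With [f] in the region, the points where every form is at least its value at [f] make up
   a translated cone; the other points lie on finitely many level sets of one of the forms,
   which is thereby no longer needed as an inequality. *)
Lemma region_decomposition K ls : affine_closed K ->
  finite_disjoint_union_of normal_translate (region K ls).
Proof.
have [n] := ubnP (size ls); elim: n K ls => // n IH K ls le_n cK.
have [[f [Kf lsf]]|T0] := pselect (exists f, region K ls f); last first.
  rewrite (_ : region K ls = set0); first exact: finite_disjoint_union_of0.
  by apply/seteqP; split=> x // Tx; case: T0; exists x.
(* The forms in [bs] have already been normalized to vanish at [f]; those in [bs'] remain to be
   treated. *)
suff inner bs bs' : (size (bs ++ bs') < n.+1)%N ->
    all (fun l : affine_form V => l f == 0) bs ->
    all (fun l : affine_form V => 0 <= l f) bs' ->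
    finite_disjoint_union_of normal_translate (region K (bs ++ bs')).
  exact: (inner [::]).
elim: bs' bs => [|b bs' IHb] bs.
  by rewrite cats0 => _ bsf _; apply: finite_disjoint_union_of1; exact: region_apex bsf.
rewrite size_cat /= addnS -size_cat => lt_n bsf /= /andP[bf bs'f].
(* [b0] is [b - b f]. Where it is negative, [b] takes one of the values [0, ..., b f - 1]; on such a
   level set [b] is dropped from the list and the outer induction applies. *)
pose b0 := affine_comb 1 b 0 b (- b f).
have -> : region K (bs ++ b :: bs') = region K ((b0 :: bs) ++ bs') `|`
    \bigcup_(v : 'I_`|b f|) region (K `&` [set x | b x = v]) (bs ++ bs').
  apply/seteqP; split=> x; rewrite /region /= !all_cat /=.
    case=> Kx /and3P[bsx bx bs'x].
    have [le_b|lt_b] := lerP (b f) (b x).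
      by left; split=> //; rewrite bsx bs'x andbT /=; lia.
    have vlt : (`|b x| < `|b f|)%N by lia.
    right; exists (Ordinal vlt) => //=; split; last by rewrite all_cat bsx bs'x.
    by split=> //=; lia.
  case=> [[Kx /and3P[b0x bsx bs'x]]|[v _ [[Kx /= bx]]]].
    by split=> //; rewrite bsx bs'x andbT; move: b0x; lia.
  by rewrite all_cat => /andP[bsx bs'x]; split=> //; rewrite bsx bs'x bx.
apply: finite_disjoint_union_ofU.
- by apply: IHb => //=; rewrite bsf andbT; apply/eqP; rewrite /=; ring.
- apply: finite_disjoint_union_of_bigcup => [v|].
    apply: IH; first by lia.
    by apply: affine_closedI => //; exact: affine_closed_level.
  move=> v w _ _ [x [[[_ /= bv] _] [[_ /= bw] _]]].
  by apply/val_inj; move: bw; rewrite bv => -[].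
- apply/seteqP; split=> x // [[_]]; rewrite /= => /andP[b0x _] [v _ [[_ /= bx] _]].
  by have := ltn_ord v; move: b0x; rewrite bx; lia.
Qed.

Lemma cell_decomposition (B : seq (atom V)) :
  finite_disjoint_union_of normal_translate (cell B).
Proof.
(* The atoms of the cell are absorbed one at a time: inequalities go to [ls], divisibilities to
   [K]. *)
suff gen K ls : affine_closed K ->
    finite_disjoint_union_of normal_translate (region K ls `&` cell B).
  by have := gen setT [::]; rewrite (_ : region _ _ = setT) ?setTI; [apply | apply/seteqP].
elim: B K ls => [|[l|m l] B IH] K ls cK.
- rewrite (_ : cell [::] = setT) ?setIT; last by apply/seteqP.
  exact: region_decomposition.
- rewrite (_ : _ `&` _ = region K (l :: ls) `&` cell B); first exact: IH.
  apply/seteqP; split=> x; rewrite /region /cell /=.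
    by case=> [[Kx lsx] /andP[lx Bx]]; rewrite lx.
  by case=> [[Kx /andP[lx lsx]] Bx]; rewrite lx.
- rewrite (_ : _ `&` _ = region (K `&` [set x | (m.+1 %| l x)%Z]) ls `&` cell B).
    by apply: IH; apply: affine_closedI => //; exact: affine_closed_dvd.
  apply/seteqP; split=> x; rewrite /region /cell /=.
    by case=> [[Kx lsx] /andP[lx Bx]].
  by case=> [[[Kx lx] lsx] Bx]; rewrite lx.
Qed.

(** A point outside the cell of [a :: C] either fails [a], or satisfies [a] and fails [C]; these
    cases are disjoint. Failure of an atom is itself a finite disjoint union of atoms. *)
Lemma cell_diff_decomposition (B : seq (atom V)) Cs :
  finite_disjoint_union_of normal_translate
    (cell B `&` [set x | ~~ has (all (holds x)) Cs]).
Proof.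
elim: Cs B => [|C Cs IH] B.
  by rewrite (_ : mkset _ = setT) ?setIT; [exact: cell_decomposition | apply/seteqP].
elim: C B => [|a C IHC] B.
  rewrite (_ : _ `&` _ = set0); first exact: finite_disjoint_union_of0.
  by apply/seteqP; split=> x // -[].
pose N := [set x | ~~ has (all (holds x)) Cs].
have -> : cell B `&` [set x | ~~ has (all (holds x)) ((a :: C) :: Cs)] =
    (cell B `&` [set x | ~~ holds x a] `&` N) `|`
    (cell (a :: B) `&` [set x | ~~ has (all (holds x)) (C :: Cs)]).
  apply/seteqP; split=> x; rewrite /cell /N /= ?negb_or.
    case=> Bx /andP[].
    case: (boolP (holds x a)) => /= ax; [right | left]; rewrite ?Bx; split=> //.
    exact/andP.
  case=> [[[Bx /negPf ax] Nx]|[/andP[ax Bx]]]; last by rewrite ax.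
  by rewrite ax.
apply: finite_disjoint_union_ofU; last 2 first.
- exact: IHC.
- by apply/seteqP; split=> x // [[[_ /= /negP ax] _] [/= /andP[]]].
case: a {IHC} => [l|m l].
  (* Over the integers, [l x < 0] means [0 <= - l x - 1]. *)
  rewrite (_ : cell B `&` _ = cell (Nonneg (affine_comb (-1) l 0 l (-1)) :: B)).
    exact: IH.
  apply/seteqP; split=> x; rewrite /cell /=.
    by case=> Bx lx; rewrite Bx andbT; lia.
  by case/andP=> lx Bx; split=> //; lia.
(* Divisibility of [res r] by [m.+1] says that [l x] has residue [r.+1]; as [r] ranges over ['I_m],
   these are all the nonzero residues. *)
pose res r := affine_comb 1 l 0 l (- r.+1%:Z).
rewrite (_ : cell B `&` _ `&` N = \bigcup_(r : 'I_m) (cell (Divides m (res r) :: B) `&` N)).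
  apply: finite_disjoint_union_of_bigcup => [r|]; first exact: IH.
  move=> r s _ _ [x [[/= /andP[rx _] _] [/= /andP[sx _] _]]]; apply/val_inj => /=.
  have /= := rpredB rx sx; have := ltn_ord r; have := ltn_ord s.
  move=> sm rm /dvdzP[k E]; have {}E : s%:Z - r%:Z = k * m.+1 by move: E; lia.
  by have [k0|k0|k0] := ltrgtP k 0; nia.
apply/seteqP; split=> x.
  case=> [[Bx /= lx] Nx].
  have m_gt0 : (0 : int) < m.+1 by [].
  have s_neq0 : (l x %% m.+1)%Z != 0 by apply: contraNneq lx => /dvdz_mod0P.
  have s_ge0 := modz_ge0 (l x) (lt0r_neq0 m_gt0).
  have s_lt := ltz_pmod (l x) m_gt0.
  have lE := divz_eq (l x) m.+1.
  move: (l x %% m.+1)%Z (l x %/ m.+1)%Z s_neq0 s_ge0 s_lt lE => s q s_neq0 s_ge0 s_lt lE.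
  have r_lt : (`|s|.-1 < m)%N by lia.
  exists (Ordinal r_lt) => //; split=> //; rewrite /cell /= Bx andbT.
  by apply/dvdzP; exists q; rewrite lE; lia.
case=> r _ [/= /andP[rx Bx] Nx]; split=> //; split=> //=.
apply/negP => lx; have /= := rpredB lx rx; have := ltn_ord r.
move=> rm /dvdzP[k E]; have {}E : r.+1%:Z = k * m.+1 by move: E; lia.
by have [k0|k0|k0] := ltrgtP k 0; nia.
Qed.

(** Each cell is stripped of the cells after it in the list, which makes the union disjoint. *)
Lemma definable_decomposition X : definable X ->
  finite_disjoint_union_of normal_translate X.
Proof.
move=> [Bs ->]; elim: Bs => [|B Bs IH].
  by rewrite (_ : mkset _ = set0); [exact: finite_disjoint_union_of0 | apply/seteqP; split].
rewrite (_ : mkset _ = [set x | has (all (holds x)) Bs] `|`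
    (cell B `&` [set x | ~~ has (all (holds x)) Bs])).
  apply: finite_disjoint_union_ofU => //; first exact: cell_diff_decomposition.
  by apply/seteqP; split=> x // -[/= Bsx [_ /negP]].
apply/seteqP; split=> x; rewrite /cell /=.
  by case: (boolP (has _ _)) => Bsx; [left | rewrite orbF; right].
by case=> [->|[->]]; rewrite ?orbT.
Qed.

End Decomposition.

(** * Definability of translates of affine semigroups *)

Section AffineSemigroupDefinable.
Variable d : nat.
Local Notation V := 'rV[int]_d.

(** Written with backward steps, so that each generator adds one ray in the form treated by
    [definable_ray]. *)
Fixpoint nat_span (gs : seq V) : set V :=
  if gs is g :: gs' then [set x | exists n, nat_span gs' (x - g *+ n)] else [set 0].

Lemma smallest_submonoid_seq (gs : seq V) : smallest (@submonoid d) [set` gs] = nat_span gs.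
Proof.
apply/seteqP; split.
  apply: smallest_sub.
    elim: gs => [|g gs [h0 hD]] /=; split=> [|x y]; rewrite !inE /=.
    - by [].
    - by move=> -> ->; rewrite addr0.
    - by exists 0%N; rewrite mulr0n subr0; rewrite inE in h0.
    - move=> [n hn] [m hm]; exists (n + m)%N; have := hD (x - g *+ n) (y - g *+ m).
      by rewrite !inE mulrnDr opprD addrACA; apply.
  elim: gs => [|g gs IH] x //=; rewrite inE => /orP[/eqP->|xg].
    exists 1%N; rewrite mulr1n subrr; elim: gs {IH} => //= h gs IH.
    by exists 0%N; rewrite mulr0n subr0.
  by exists 0%N; rewrite mulr0n subr0; exact: IH.
move=> x hx B [[B0 BD] gB]; rewrite inE in B0.
have {}BD y z : B y -> B z -> B (y + z) by move=> By Bz; have := BD y z; rewrite !inE; apply.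
elim: gs x hx gB => [|g gs IH] x /=; first by move=> ->.
move=> [n hn] gB; rewrite -(subrK (g *+ n) x); apply: (BD).
  by apply: IH hn _ => y ys; apply: gB; rewrite /= inE ys orbT.
elim: n {hn} => [|n IHn]; first by rewrite mulr0n.
by rewrite mulrS; apply: BD IHn; apply: gB; rewrite /= mem_head.
Qed.

Fact coord_affine_subproof i (x y z : V) : (x - y + z) 0 i = x 0 i - y 0 i + z 0 i.
Proof. by rewrite !mxE. Qed.
Definition coord_form i := AffineForm (coord_affine_subproof i).

Lemma definable_origin : definable ([set 0] : set V).
Proof.
pose neg (l : affine_form V) := affine_comb (-1) l 0 l 0.
rewrite (_ : [set 0] = cell ([seq Nonneg (coord_form i) | i <- enum 'I_d] ++
    [seq Nonneg (neg (coord_form i)) | i <- enum 'I_d])); first exact: definable_cell.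
apply/seteqP; split=> x; rewrite /cell /= all_cat !all_map.
  by move=> ->; apply/andP; split; apply/allP => i _ /=; rewrite !mxE.
move=> /andP[/allP ge0 /allP le0]; apply/rowP => i.
have := le0 i; have := ge0 i; rewrite -enumT mem_enum mxE /= => /(_ isT) + /(_ isT).
by move: (x 0 i) => a; lia.
Qed.

Lemma definable_translate (A X : set V) : affine_semigroup A -> translate A X -> definable X.
Proof.
move=> [G /finite_seqP[gs ->] ->] [f ->]; rewrite smallest_submonoid_seq.
rewrite (_ : _ @` _ = [set x | nat_span gs (x - f)]).
  apply: definable_shift; elim: gs => [|g gs IH] /=; first exact: definable_origin.
  exact: definable_ray.
apply/seteqP; split=> x /=; first by case=> a ha <-; rewrite addrAC subrr add0r.
by exists (x - f); rewrite // addrC subrK.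
Qed.

End AffineSemigroupDefinable.

(** * The cycle of equivalences *)

Lemma translate_fg_module d (A X : set 'rV[int]_d) : translate A X -> fg_module A X.
Proof.
move=> [f ->]; exists [set f]; first exact: finite_set1.
apply/seteqP; split=> x; first by case=> a Aa <-; exists f => //; exists a.
by case=> _ -> [a Aa <-]; exists a.
Qed.

Theorem theorem2p6 (R : realType) (d : nat) (W : set 'rV[int]_d) :
  [<-> has_affine_stratification W;
       finite_union_of
         (fun V => exists2 A, affine_semigroup A & fg_module A V) W;
       finite_union_of
         (fun V => exists2 A, affine_semigroup A & translate A V) W;
       finite_union_of
         (fun V => exists2 A, normal_affine_semigroup R A & translate A V) W;
       finite_disjoint_union_of
         (fun V => exists2 A, normal_affine_semigroup R A & translate A V) W;
       finite_disjoint_union_of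
         (fun V => exists2 A, affine_semigroup A & translate A V) W].
Proof.
(* This implication carries the substance of both middle steps of the cycle: forgetting disjointness
   gives the normal union, and Gordan's lemma brings a normal union back to its hypothesis. *)
have affine_to_normal : finite_union_of
      (fun V => exists2 A, affine_semigroup A & translate A V) W ->
    finite_disjoint_union_of
      (fun V => exists2 A, normal_affine_semigroup R A & translate A V) W.
  move=> [r [W_ [WP ->]]]; apply: definable_decomposition.
  by apply: definable_bigcup => i; have [A] := WP i; exact: definable_translate.
have normal_to_affine (V : set 'rV[int]_d) :
    (exists2 A, normal_affine_semigroup R A & translate A V) ->
    exists2 A, affine_semigroup A & translate A V.
  by move=> [A /gordan sA tA]; exists A.
tfae.
- exact: finite_union_of_disjoint.
- move=> [r [W_ [WP ->]]]; apply: finite_union_of_bigcup => i.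
  have [A sA [F /finite_seqP[fs ->] ->]] := WP i.
  (* [F + A] is the union, possibly overlapping, of the translates [f + A] over the finite set of
     generators. *)
  rewrite (_ : image2 _ _ _ =
      \bigcup_(j : 'I_(size fs)) [set tnth (in_tuple fs) j + a | a in A]).
    by apply: finite_union_ofT => j; exists A => //; exists (tnth (in_tuple fs) j).
  apply/seteqP; split=> x.
    move=> [f ffs [a Aa <-]]; have /tnthP[j ->] : f \in in_tuple fs by [].
    by exists j => //; exists a.
  by move=> [j _ [a Aa <-]]; exists (tnth (in_tuple fs) j); [exact: mem_tnth | exists a].
- by move/affine_to_normal/finite_union_of_disjoint.
- by move/(finite_union_of_sub normal_to_affine).
- exact: finite_disjoint_union_of_sub.
- apply: finite_disjoint_union_of_sub => X [A sA /translate_fg_module fX].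
  by exists A.
Qed.
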